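(* Let $n\ge 1$, $Q=2n+2$, and let $p,q,\alpha,\beta,\gamma$ be real numbers with $1<p<\infty$, $1\le q<\infty$, $\beta<Q(p-1)$, $Q+\gamma>0$ and $0\le\alpha<\frac{\beta}{p-1}$. If $$\frac{\gamma+Q}{q}+\alpha=\frac{\beta+Q}{p},$$ then the fractional Hardy operator $\mathcal{H}_\alpha$ on the Heisenberg group $\mathbb{H}^n$ satisfies $$\left\|\mathcal{H}_\alpha\right\|_{L^p(\mathbb{H}^n,|x|_h^{\beta})\to L^{q,\infty}(\mathbb{H}^n,|x|_h^{\gamma})}=\left(\frac{\omega_Q}{Q+\gamma}\right)^{\frac1q}\left(\frac{\omega_Q(p-1)}{pQ-Q-\beta}\right)^{\frac1{p'}},$$ where $p'=p/(p-1)$.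
   Context: The Heisenberg group $\mathbb{H}^n$ is, as a manifold, $\mathbb{R}^{2n+1}$; its Haar measure is Lebesgue measure $dx$ on $\mathbb{R}^{2n+1}$, its dilations are $\delta_r(x_1,\dots,x_{2n},x_{2n+1})=(rx_1,\dots,rx_{2n},r^2x_{2n+1})$ for $r>0$, and its homogeneous dimension is $Q=2n+2$. The homogeneous norm is $|x|_h=\big[\big(\sum_{i=1}^{2n}x_i^2\big)^2+x_{2n+1}^2\big]^{1/4}$. Put $B(0,1)=\{x:|x|_h<1\}$, $\Omega_Q=|B(0,1)|$ (Lebesgue measure) and $\omega_Q=Q\,\Omega_Q$. For $0\le\alpha<Q$ the $n$-dimensional fractional Hardy operator is $$\mathcal{H}_\alpha f(x)=\frac{1}{|x|_h^{Q-\alpha}}\int_{|y|_h<|x|_h}f(y)\,dy,\qquad x\in\mathbb{H}^n\setminus\{0\},$$ for locally integrable $f$. For a positive measurable weight $w$ (defined almost everywhere), $\|f\|_{L^p(\mathbb{H}^n,w)}=\big(\int_{\mathbb{H}^n}|f(x)|^pw(x)\,dx\big)^{1/p}$ and $$\|f\|_{L^{q,\infty}(\mathbb{H}^n,w)}=\sup_{\lambda>0}\lambda\Big(\int_{\{x:|f(x)|>\lambda\}}w(x)\,dx\Big)^{1/q}.$$ The operator norm $\|T\|_{X\to Y}$ is the supremum of $\|Tf\|_Y/\|f\|_X$ over $f\in X$ with $0<\|f\|_X<\infty$. *)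

(* Defs.v *)
From HB Require Import structures.
From mathcomp Require Import all_boot all_order all_algebra.
From mathcomp Require Import all_classical all_reals all_analysis.

Set Implicit Arguments.
Unset Strict Implicit.
Unset Printing Implicit Defensive.

Import Order.TTheory GRing.Theory Num.Theory.
Import numFieldNormedType.Exports.

Local Open Scope classical_set_scope.
Local Open Scope ring_scope.

Section tuple_cons.
Context d (T : measurableType d) (m : nat).

Definition tuple_cons (x : T * m.-tuple T) : m.+1.-tuple T :=
  [tuple of x.1 :: x.2].

Definition tuple_uncons (x : m.+1.-tuple T) : T * m.-tuple T :=
  (thead x, [tuple of behead x]).

Lemma tuple_consK : cancel tuple_cons tuple_uncons.
Proof. by case=> a t; congr pair; apply/val_inj. Qed.

Lemma tuple_unconsK : cancel tuple_uncons tuple_cons.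
Proof. by move=> x; rewrite [RHS]tuple_eta. Qed.

Lemma measurable_tuple_cons : measurable_fun setT tuple_cons.
Proof. exact: measurable_cons. Qed.

Lemma measurable_tuple_uncons : measurable_fun setT tuple_uncons.
Proof.
by apply: measurable_fun_pair; [exact: measurable_tnth|exact: measurable_behead].
Qed.

End tuple_cons.

Section tuple_measure.
Local Open Scope ereal_scope.
Context d (T : measurableType d) (R : realType).
Variable mu : {sigma_finite_measure set T -> \bar R}.

Section step.
Context (m : nat) (nu : {sigma_finite_measure set (m.-tuple T) -> \bar R}).

Definition measure_cons : set (m.+1.-tuple T) -> \bar R :=
  pushforward (mu \x nu) (@tuple_cons _ T m).

Let measure_cons0 : measure_cons set0 = 0.
Proof. by rewrite /measure_cons /pushforward preimage_set0 measure0. Qed.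

Let measure_cons_ge0 A : 0 <= measure_cons A.
Proof. exact: (measure_ge0 (mu \x nu)). Qed.

Let measure_cons_sigma_additive : semi_sigma_additive measure_cons.
Proof.
have mf := @measurable_tuple_cons _ T m.
move=> F mF tF mUF; rewrite /measure_cons /pushforward preimage_bigcup.
apply: measure_semi_sigma_additive.
- by move=> n; rewrite -[X in measurable X]setTI; exact: mf.
- apply/trivIsetP => /= i j _ _ ij; rewrite -preimage_setI.
  by move/trivIsetP : tF => /(_ _ _ _ _ ij) ->//; rewrite preimage_set0.
- by rewrite -preimage_bigcup -[X in measurable X]setTI; exact: mf.
Qed.

HB.instance Definition _ := isMeasure.Build _ _ _ measure_cons
  measure_cons0 measure_cons_ge0 measure_cons_sigma_additive.

Let measure_cons_sigma_finite : sigma_finite setT measure_cons.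
Proof.
have /sigma_finiteP[F [TF ndF Foo]] := sigma_finiteT mu.
have /sigma_finiteP[G [TG ndG Goo]] := sigma_finiteT nu.
exists (fun n => @tuple_uncons _ T m @^-1` (F n `*` G n)).
  apply/esym; rewrite -subTset => x _.
  have [i _ Fi] : (\bigcup_n F n) (tuple_uncons x).1 by rewrite -TF.
  have [j _ Gj] : (\bigcup_n G n) (tuple_uncons x).2 by rewrite -TG.
  exists (maxn i j) => //; split.
  - by move: Fi; exact/subsetPset/ndF/leq_maxl.
  - by move: Gj; exact/subsetPset/ndG/leq_maxr.
move=> k; have [mF Fk] := Foo k; have [mG Gk] := Goo k; split.
  rewrite -[X in measurable X]setTI; apply: measurable_tuple_uncons => //.
  exact: measurableX.
rewrite /measure_cons /pushforward -comp_preimage.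
have -> : @tuple_uncons _ T m \o @tuple_cons _ T m = id.
  by apply/funext => x /=; rewrite tuple_consK.
by rewrite product_measure1E// lte_mul_pinfty// ge0_fin_numE.
Qed.

HB.instance Definition _ := Measure_isSigmaFinite.Build _ _ _ measure_cons
  measure_cons_sigma_finite.

End step.

(* The m-fold product measure on m-tuples, equipped with the product
   sigma-algebra. *)
Fixpoint tuple_measure (m : nat) :
    {sigma_finite_measure set (m.-tuple T) -> \bar R} :=
  if m is m'.+1 then measure_cons (tuple_measure m') else \d_[tuple].

Lemma tuple_measure_box (m : nat) (A : 'I_m -> set T) :
  (forall i, measurable (A i)) ->
  tuple_measure m [set x | forall i, A i (tnth x i)] = \prod_(i < m) mu (A i).
Proof.
elim: m A => [|m IH] A mA /=.
  rewrite big_ord0 diracE mem_set//=; by case.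
rewrite big_ord_recl -IH => [|i]; last exact: mA.
rewrite -product_measure1E//.
  rewrite /measure_cons /pushforward; congr product_measure1.
  apply/seteqP; split=> [[a t] /= H|[a t] /= [Ha Ht] i].
    split=> [|i]; first exact: (H ord0).
    by have := H (lift ord0 i); rewrite tnthS.
  by case: (unliftP ord0 i) => [j ->|->] //; rewrite tnthS.
rewrite (_ : [set x | _] = \bigcap_(i in [set: 'I_m])
    ((fun x : m.-tuple T => tnth x i) @^-1` A (lift ord0 i))).
  apply: fin_bigcap_measurable => [|i _]; first exact: finite_finset.
  by rewrite -[X in measurable X]setTI; exact: measurable_tnth.
by apply/seteqP; split=> x /= H i; [move=> _|]; exact: H.
Qed.

End tuple_measure.

Section weighted_norms.
Local Open Scope ereal_scope.
Context d (T : measurableType d) (R : realType).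
Variables (mu : {measure set T -> \bar R}) (w : T -> R).

Definition weighted_Lnorm (p : R) (g : T -> \bar R) : \bar R :=
  (\int[mu]_x (`|g x| `^ p * (w x)%:E)) `^ p^-1.

Definition weighted_weak_Lnorm (q : R) (g : T -> \bar R) : \bar R :=
  ereal_sup [set l%:E *
    (\int[mu]_(x in [set x | l%:E < `|g x|]) (w x)%:E) `^ q^-1
    | l in [set l : R | (0 < l)%R]].

End weighted_norms.

Section operator_norm.
Local Open Scope ereal_scope.
Context d (T : measurableType d) (R : realType).

(* The operator may take extended real values; the functions it is applied to
   are the real-valued measurable f with 0 < normX f < +oo. *)
Definition operator_norm (normX normY : (T -> \bar R) -> \bar R)
    (op : (T -> R) -> (T -> \bar R)) : \bar R :=
  ereal_sup [set normY (op f) / normX (EFin \o f) | f in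
    [set f : T -> R | [/\ measurable_fun setT f,
      0 < normX (EFin \o f) & normX (EFin \o f) < +oo]]].

End operator_norm.

(* Only the underlying measure space and the homogeneous norm of the Heisenberg
   group are used, not its group law. *)
Notation heisenberg R n := ((n.*2.+1).-tuple (measurableTypeR R)).

Section heisenberg.
Context (R : realType) (n : nat).
Implicit Types x y : heisenberg R n.

Definition haar : {sigma_finite_measure set (heisenberg R n) -> \bar R} :=
  tuple_measure (@lebesgue_measure R) n.*2.+1.

Definition homdim : R := (2 * n + 2)%:R.

Definition hnorm x : R :=
  ((\sum_(i < n.*2) tnth x (widen_ord (leqnSn n.*2) i) ^+ 2) ^+ 2
   + tnth x ord_max ^+ 2) `^ (4%:R^-1).

Definition hball (r : R) : set (heisenberg R n) := [set x | hnorm x < r].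

Definition Omega_Q : \bar R := haar (hball 1).

Definition omega_Q : \bar R := (homdim%:E * Omega_Q)%E.

(* At x = 0, a null set where H_alpha f is usually left undefined, this is 0,
   the integral being over the empty set. *)
Definition hardy (alpha : R) (f : heisenberg R n -> R) x : \bar R :=
  (((hnorm x `^ (homdim - alpha))^-1)%:E
    * \int[haar]_(y in hball (hnorm x)) (f y)%:E)%E.

End heisenberg.

(* Main.v *)
Require Import Defs.
From mathcomp Require Import all_boot all_order all_algebra.
From mathcomp Require Import all_classical all_reals all_analysis.
From mathcomp Require Import measurable_realfun exponential_distribution.
From mathcomp Require Import ring lra.

Import Order.TTheory GRing.Theory Num.Theory.
Local Open Scope ring_scope.

(* Write [Q] for the homogeneous dimension, [w = Q |B(0,1)|] and
   [a = beta / (p - 1)], so that [a < Q].  Dilations give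
   [|B(0,r)| = r^Q |B(0,1)|], hence [int_(|y| < r) |y|^s dy = w r^(Q+s) / (Q+s)]
   for [s > -Q].

   Upper bound: Hoelder's inequality with the weights [|y|^(beta/p)] and
   [|y|^(-beta/p)] on the ball of radius [|x|] gives the pointwise estimate
   [|H_alpha f (x)| <= A ||f|| |x|^(- (Q+gamma)/q)] with
   [A = (w / (Q - a))^(1/p')], the exponent of [|x|] being given by the scaling
   relation.  Hence [{|H_alpha f| > l}] lies in the ball whose radius [rho]
   satisfies [rho^((Q+gamma)/q) = A ||f|| / l], and the [|x|^gamma]-measure of
   that ball is [w rho^(Q+gamma) / (Q+gamma)].

   The supremum is attained at [f y = |y|^(-a)] on the unit ball, and [0]
   elsewhere: with [C = w / (Q - a)], [H_alpha f (x) = C |x|^(alpha - a) > C]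
   for [0 < |x| < 1] since [alpha < a], so the level [l = C] alone already
   yields the constant, [||f||] being [C^(1/p)]. *)

(** * Densities and the exponential law of rate 1 *)

Local Open Scope classical_set_scope.

(** Since [nu] vanishes on [mu]-null sets, it has a Radon-Nikodym derivative [h]. The functions [h]
    and [g] have the same integral over every measurable set, so they agree almost everywhere, and
    [h] may be replaced by [g] under the integral. *)
Lemma ge0_integral_density {d} {T : measurableType d} {R : realType}
    {mu : {sigma_finite_measure set T -> \bar R}}
    {nu : {finite_measure set T -> \bar R}} {g : T -> \bar R} {f : T -> \bar R} :
  (forall x, 0 <= g x)%E -> mu.-integrable setT g ->
  (forall A, measurable A -> nu A = \int[mu]_(x in A) g x)%E ->
  (forall x, 0 <= f x)%E -> measurable_fun [set: T] f ->
  (\int[nu]_x f x = \int[mu]_x (f x * g x))%E.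
Proof.
move=> g0 ig nuE f0 mf.
have numu : nu `<< mu.
  apply/null_content_dominatesP => A mA muA0.
  rewrite nuE//; apply: null_set_integral => //.
  by apply/measurable_funTS/(measurable_int mu).
rewrite -(Radon_Nikodym_SigmaFinite.change_of_variables numu)//.
pose h := Radon_Nikodym_SigmaFinite.f nu mu.
have ih : mu.-integrable setT h by exact: Radon_Nikodym_SigmaFinite.f_integrable.
have h0 x : (0 <= h x)%E by exact: Radon_Nikodym_SigmaFinite.f_ge0.
apply: ge0_ae_eq_integral => //.
- by apply: emeasurable_funM => //; exact: measurable_int ih.
- by apply: emeasurable_funM => //; exact: measurable_int ig.
- by move=> x _; rewrite mule_ge0.
- by move=> x _; rewrite mule_ge0.
apply: ae_eqe_mul2l; apply: integral_ae_eq => //.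
  exact: measurable_int ig.
by move=> E _ mE; rewrite -nuE// -Radon_Nikodym_SigmaFinite.f_integral.
Qed.

Section std_exponential.
Context {R : realType}.

Definition std_exponential : probability (measurableTypeR R) R :=
  exponential_distribution_exponential_prob__canonical__probability_measure_Probability
    (@ltr01 R).

Lemma std_exponentialE (A : set R) :
  std_exponential A = (\int[lebesgue_measure]_(x in A) (exponential_pdf 1 x)%:E)%E.
Proof. by []. Qed.

Lemma std_exponential_itv0y : std_exponential `[0, +oo[ = 1%E.
Proof.
rewrite std_exponentialE integral_mkcond -(@integral_exponential_pdf _ (1 : R))//.
apply: eq_integral => x _; rewrite patchE; case: ifPn => // /negP.
by rewrite inE/= in_itv/= andbT => /negP; rewrite -ltNge => /lt0_exponential_pdf ->.
Qed.

(** These tails determine the law, since the open rays generate the Borel sets. For [t > 0] the mass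
    of [[0, t]] is subtracted from the total mass on [[0, +oo[]; the maximum with [0] covers
    negative [t], where the ray has full mass. *)
Lemma std_exponential_itvoy (t : R) :
  std_exponential `]t, +oo[ = (expR (- Num.max 0 t))%:E.
Proof.
have [t0|t0] := leP t 0.
  rewrite oppr0 expR0; apply/eqP; rewrite eq_le probability_le1//=.
  have [->|tn0] := eqVneq t 0.
    rewrite -std_exponential_itv0y !std_exponentialE.
    rewrite integral_itv_obnd_cbnd//.
    by apply/measurable_EFinP/measurable_funTS; exact: measurable_exponential_pdf.
  apply: (@le_trans _ _ (std_exponential `[0, +oo[)).
    by rewrite std_exponential_itv0y.
  apply: le_measure; rewrite ?inE//.
  by apply: subset_itvr; rewrite bnd_simp lt_neqAle tn0.
have := std_exponential_itv0y.
rewrite (@itv_bndbnd_setU _ _ (BLeft 0) (BRight t) +oo%O) ?bnd_simp ?ltW//.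
rewrite measureU//; last first.
  apply/seteqP; split => x //=.
  by rewrite !in_itv/= andbT => -[/andP[_ /le_lt_trans] h /h]; rewrite ltxx.
rewrite [X in (X + _)%E]exponential_prob_itv0c// mulN1r => h.
have [r er] : exists r, std_exponential `]t, +oo[ = r%:E.
  by exists (fine (std_exponential `]t, +oo[)); rewrite fineK ?fin_num_measure.
by move: h; rewrite er [X in (_ + X)%E]er -EFinB -EFinD => -[h]; congr EFin; lra.
Qed.

(** Multiplying the density of rate [1] by [exp (- s t)] gives the density of rate [1 + s] up to the
    factor [1 / (1 + s)], and a density integrates to [1]. *)
Lemma integral_std_exponential_expR (s : R) : -1 < s ->
  (\int[std_exponential]_t (expR (- (s * t)))%:E = ((1 + s)^-1)%:E)%E.
Proof.
move=> s1; have s0 : 0 < 1 + s by rewrite -ltrBlDl sub0r.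
have m s' : measurable_fun [set: measurableTypeR R] (fun t : measurableTypeR R =>
    (expR (- (s' * t)))%:E).
  apply/measurable_EFinP; apply: measurableT_comp => //.
  by apply: measurableT_comp => //; exact: mulrl_measurable.
have pdf0 r x : 0 < r -> (0 <= (exponential_pdf r x)%:E :> \bar R)%E.
  by move=> r0; rewrite lee_fin exponential_pdf_ge0// ltW.
rewrite (@ge0_integral_density _ _ _ lebesgue_measure std_exponential
  (EFin \o exponential_pdf 1))//.
- rewrite (eq_integral (fun t : measurableTypeR R =>
    ((1 + s)^-1)%:E * (exponential_pdf (1 + s) t)%:E)%E).
    rewrite ge0_integralZl_EFin ?invr_ge0 ?ltW//.
    - by rewrite integral_exponential_pdf// mule1.
    - by move=> x _; exact: pdf0.
    - by apply/measurable_EFinP; exact: measurable_exponential_pdf.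
  move=> t _ /=; rewrite -!EFinM; congr EFin.
  rewrite /exponential_pdf !patchE; case: ifPn => _; last by rewrite !mulr0.
  rewrite mulKf ?gt_eqF// mul1r -expRD; congr expR; ring.
- by move=> x; exact: pdf0.
- exact: integrable_exponential_pdf.
Qed.

End std_exponential.

(** * Scaling of Lebesgue measure and of its powers *)

Lemma lebesgue_measure_mul_preimage {R : realType} {c : R} {A : set R} :
  0 < c -> measurable A ->
  lebesgue_measure ( *%R c @^-1` A) = (c^-1%:E * lebesgue_measure A)%E.
Proof.
move=> c0 mA.
have mc : measurable_fun [set: measurableTypeR R] ( *%R c : _ -> measurableTypeR R).
  exact: mulrl_measurable.
(* Lebesgue measure is determined by its values on the intervals []a, b]], so it is enough that [c]
   times the image measure agrees with it there. *)
pose m' : {measure set (measurableTypeR R) -> \bar R} := mscale (NngNum (ltW c0))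
  (pushforward lebesgue_measure ( *%R c : measurableTypeR R -> measurableTypeR R)).
suff -> : lebesgue_measure A = m' mc A.
  by rewrite /m' /mscale/= muleA -EFinM mulVf ?gt_eqF// mul1e.
apply: lebesgue_measure_unique => // _ [[a b]/= _ <-].
rewrite /mscale/= /pushforward.
have -> : *%R c @^-1` `]a, b] = `]a / c, b / c].
  apply/seteqP; split => x /=; rewrite !in_itv/=;
    by rewrite ltr_pdivrMr// ler_pdivlMr// mulrC.
rewrite !lebesgue_measure_itv/= !lte_fin ltr_pM2r ?invr_gt0//.
case: ifPn => _; last by rewrite mule0.
by rewrite -!EFinB -EFinM; congr EFin; field; rewrite gt_eqF.
Qed.

Section dilation.
Context {R : realType}.

Definition dilation {m} (c : 'I_m -> R) (x : m.-tuple (measurableTypeR R)) :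
  m.-tuple (measurableTypeR R) := [tuple c i * tnth x i | i < m].

Lemma measurable_dilation {m} (c : 'I_m -> R) : measurable_fun setT (dilation c).
Proof.
apply/measurable_fun_tnthP => i.
rewrite (_ : _ \o _ = fun x => c i * tnth x i); last first.
  by apply/funext => x /=; rewrite tnth_mktuple.
by apply: measurable_funM => //; exact: measurable_tnth.
Qed.

(** By induction on [m]: through [tuple_cons] the dilation becomes the product map [phi] of a
    scaling of the line and a dilation with one coordinate fewer. A product measure is determined by
    its values on rectangles, where the two scaling factors multiply. *)
Lemma tuple_measure_dilation {m} {c : 'I_m -> R}
    {A : set (m.-tuple (measurableTypeR R))} :
  (forall i, 0 < c i) -> measurable A ->
  tuple_measure (@lebesgue_measure R) m (dilation c @^-1` A)
    = ((\prod_i c i)^-1%:E * tuple_measure (@lebesgue_measure R) m A)%E.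
Proof.
elim: m c A => [|m IH] c A c0 mA.
  rewrite big_ord0 invr1 mul1e; congr (tuple_measure _ _ _).
  suff -> : dilation c = id by [].
  by apply/funext => x; rewrite (tuple0 (dilation c x)) (tuple0 x).
have ci0 : 0 < \prod_i c i by exact: prodr_gt0.
rewrite /= /measure_cons /pushforward.
set mu := lebesgue_measure; set nu := tuple_measure mu m.
pose c' := fun i : 'I_m => c (lift ord0 i).
pose phi (z : measurableTypeR R * m.-tuple (measurableTypeR R)) :
    measurableTypeR R * m.-tuple (measurableTypeR R) :=
  (c ord0 * z.1, dilation c' z.2).
have mphi : measurable_fun setT phi.
  apply: measurable_fun_pair.
    by apply: measurableT_comp; [exact: mulrl_measurable|exact: measurable_fst].
  by apply: measurableT_comp; [exact: measurable_dilation|exact: measurable_snd].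
have cE : dilation c \o @tuple_cons _ _ m = @tuple_cons _ _ m \o phi.
  apply/funext => -[a t]; apply: eq_from_tnth => i.
  rewrite /= tnth_mktuple; case: (unliftP ord0 i) => [j ->|->] //.
  by rewrite !tnthS tnth_mktuple.
rewrite -comp_preimage cE comp_preimage.
set B := @tuple_cons _ _ m @^-1` A.
have mB : measurable B.
  by rewrite -[B]setTI; exact: measurable_tuple_cons.
pose m' : {measure set _ -> \bar R} :=
  mscale (NngNum (ltW ci0)) (pushforward (mu \x nu)%E phi).
suff -> : (mu \x nu)%E B = m' mphi B.
  by rewrite /m' /mscale/= muleA -EFinM mulVf ?gt_eqF// mul1e.
apply: product_measure_unique => // X Y mX mY.
transitivity ((\prod_i c i)%:E * (mu \x nu)
  (( *%R (c ord0) @^-1` X) `*` (dilation c' @^-1` Y)))%E; first by [].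
rewrite product_measure1E//; last 2 first.
  rewrite -[X in measurable X]setTI; exact: mulrl_measurable.
  rewrite -[X in measurable X]setTI; exact: measurable_dilation.
rewrite [X in (_ * (X * _))%E](lebesgue_measure_mul_preimage (c0 ord0) mX).
rewrite [X in (_ * (_ * X))%E](IH c' Y)//; last by move=> i; exact: c0.
have c0n : c ord0 != 0 by rewrite gt_eqF.
have c'0n : \prod_(i < m) c' i != 0.
  by rewrite gt_eqF// prodr_gt0// => i _; exact: c0.
have e : c ord0 * (\prod_(i < m) c' i) * ((c ord0)^-1 * (\prod_(i < m) c' i)^-1) = 1.
  by field; apply/andP.
have pE : \prod_i c i = c ord0 * \prod_(i < m) c' i by rewrite big_ord_recl.
by rewrite muleACA [LHS]muleA -!EFinM pE e mul1e.
Qed.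
End dilation.

Lemma measurable_tuple_box {d} {T : measurableType d} {m} {A : 'I_m -> set T} :
  (forall i, measurable (A i)) ->
  measurable [set x : m.-tuple T | forall i, A i (tnth x i)].
Proof.
move=> mA; rewrite (_ : [set x | _] = \bigcap_(i in [set: 'I_m])
    ((fun x : m.-tuple T => tnth x i) @^-1` A i)).
  apply: fin_bigcap_measurable => [|i _]; first exact: finite_finset.
  by rewrite -[X in measurable X]setTI; exact: measurable_tnth.
by apply/seteqP; split=> x /= h i; [move=> _|]; exact: h.
Qed.

(** * Balls of the homogeneous norm and their measure *)

Section heisenberg_balls.
Context {R : realType} {n : nat}.
Local Notation H := (heisenberg R n).
Local Notation Q := (homdim R n).

Lemma homdim_gt0 : 0 < Q.
Proof. by rewrite ltr0n addn2. Qed.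

Lemma hnorm_ge0 (x : H) : 0 <= hnorm x.
Proof. exact: powR_ge0. Qed.

Lemma measurable_hnorm : measurable_fun [set: H] (@hnorm R n).
Proof.
have mt i : measurable_fun [set: H] (fun x : H => tnth x i : R).
  exact: measurable_tnth.
apply: (measurableT_comp (measurable_powR _)).
apply: measurable_funD; apply: measurable_funX; last exact: mt.
by apply: measurable_sum => i; apply: measurable_funX; exact: mt.
Qed.

Lemma measurable_hball (r : R) : measurable (@hball R n r).
Proof.
rewrite -[@hball R n r]setTI.
have -> : @hball R n r = @hnorm R n @^-1` `]-oo, r[.
  by apply/seteqP; split => x; rewrite /hball/= in_itv.
exact: measurable_hnorm.
Qed.

Definition hdilation (r : R) : H -> H :=
  dilation (fun i : 'I_n.*2.+1 => if (i < n.*2)%N then r else r ^+ 2).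

(** The weight [2] of the last coordinate makes both terms under the fourth root homogeneous of
    degree [4]. *)
Lemma hnorm_dilation (r : R) (x : H) : 0 <= r -> hnorm (hdilation r x) = r * hnorm x.
Proof.
move=> r0; rewrite /hnorm.
have -> : (\sum_(i < n.*2)
    tnth (hdilation r x) (widen_ord (leqnSn n.*2) i) ^+ 2) ^+ 2 +
    tnth (hdilation r x) ord_max ^+ 2 =
  r ^+ 4 * ((\sum_(i < n.*2) tnth x (widen_ord (leqnSn n.*2) i) ^+ 2) ^+ 2 +
    tnth x ord_max ^+ 2).
  rewrite tnth_mktuple/= ltnn.
  under eq_bigr do rewrite tnth_mktuple/= ltn_ord exprMn.
  by rewrite -mulr_sumr; ring.
rewrite powRM ?exprn_ge0 ?addr_ge0 ?sqr_ge0//.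
by rewrite -powR_mulrn// -powRrM mulfV ?pnatr_eq0// powRr1.
Qed.

(** The unit ball is the preimage of the ball of radius [r] under [hdilation r], whose coefficients
    have product [r^(2n) r^2 = r^Q]. *)
Lemma haar_hball (r : R) : 0 < r ->
  haar R n (@hball R n r) = ((r `^ Q)%:E * Omega_Q R n)%E.
Proof.
move=> r0.
pose c := fun i : 'I_n.*2.+1 => if (i < n.*2)%N then r else r ^+ 2.
have c0 i : 0 < c i by rewrite /c; case: ifPn => // _; exact: exprn_gt0.
have prodc : \prod_i c i = r `^ Q.
  rewrite big_ord_recr/= /c/= ltnn.
  under eq_bigr do rewrite ltn_ord.
  by rewrite prodr_const card_ord -exprD powR_mulrn ?ltW// mul2n.
have -> : Omega_Q R n = haar R n (hdilation r @^-1` @hball R n r).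
  congr (haar _ _ _); apply/seteqP; split => x; rewrite /hball/=;
    by rewrite hnorm_dilation ?ltW// gtr_pMr.
rewrite (tuple_measure_dilation c0 (measurable_hball r)) muleA -EFinM prodc.
by rewrite mulfV ?mul1e// gt_eqF ?powR_gt0.
Qed.

Lemma Omega_Q_lty : (Omega_Q R n < +oo)%E.
Proof.
(* The unit ball is enclosed in the cube [[-1, 1]^(2n+1)]. *)
pose A (_ : 'I_n.*2.+1) : set (measurableTypeR R) := `[-1, 1].
have sub : @hball R n 1 `<=` [set x : H | forall i, A i (tnth x i)].
  move=> x; rewrite /hball/= => x1 i.
  rewrite /A/= in_itv/= -ler_norml.
  have s1 : (\sum_(i < n.*2) tnth x (widen_ord (leqnSn n.*2) i) ^+ 2) ^+ 2
    + tnth x ord_max ^+ 2 < 1.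
    rewrite ltNge; apply/negP => h; move: x1; apply/negP; rewrite -leNgt.
    have e : (1 : R) `^ (4%:R^-1) = 1 by rewrite powR1.
    by rewrite -[leLHS]e ge0_ler_powR// nnegrE ?addr_ge0 ?sqr_ge0.
  set S := \sum_(i < n.*2) _ in s1.
  have S0 : 0 <= S by apply: sumr_ge0 => j _; exact: sqr_ge0.
  have T0 := sqr_ge0 (tnth x ord_max : R).
  have [->|ii] := eqVneq i ord_max.
    by rewrite -(@ler_sqr _ _ 1) ?nnegrE// expr1n real_normK ?num_real//; nra.
  have ilt : (i < n.*2)%N.
    by rewrite ltn_neqAle -ltnS ltn_ord andbT.
  have : tnth x i ^+ 2 <= S.
    rewrite /S (bigD1 (Ordinal ilt))//= (_ : widen_ord _ _ = i); last exact: val_inj.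
    by rewrite lerDl sumr_ge0// => j _; exact: sqr_ge0.
  rewrite -(@ler_sqr _ _ 1) ?nnegrE// expr1n real_normK ?num_real// => iS; nra.
have mA i : measurable (A i) by exact: measurable_itv.
have mB := measurable_tuple_box mA.
apply: (@le_lt_trans _ _ (haar R n [set x : H | forall i, A i (tnth x i)])).
  by apply: le_measure => //; rewrite inE//; exact: measurable_hball.
rewrite /haar tuple_measure_box//.
suff : (\prod_(i < n.*2.+1) lebesgue_measure (A i))%E \is a fin_num.
  by rewrite fin_numElt => /andP[].
elim/big_ind : _ => // [|i _]; first exact: fin_numM.
by rewrite lebesgue_measure_itv/=; case: ifP.
Qed.

Lemma Omega_Q_gt0 : (0 < Omega_Q R n)%E.
Proof.
(* The cube [[-e, e]^(2n+1)] fits in the unit ball for this [e]: as [2n e <= 1], the sum of squares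
   is at most [2n e^2 <= e], so the fourth power of the norm is at most [2 e^2 <= 1/2]. *)
pose e : R := (n.*2.+2)%:R^-1.
have e0 : 0 < e by rewrite invr_gt0 ltr0n.
have e1 : e <= 2^-1 by rewrite lef_pV2 ?posrE ?ltr0n// ler_nat.
have ne1 : n.*2%:R * e <= 1.
  by rewrite ler_pdivrMr ?ltr0n// mul1r ler_nat ltnW.
pose A (_ : 'I_n.*2.+1) : set (measurableTypeR R) := `[-e, e].
have sqA x : `[- e, e] x -> x ^+ 2 <= e ^+ 2.
  rewrite /= in_itv/= -ler_norml => xe.
  by rewrite -(real_normK (num_real x)) ler_sqr ?nnegrE// ltW.
have sub : [set x : H | forall i, A i (tnth x i)] `<=` @hball R n 1.
  move=> x xA; rewrite /hball/=.
  have S0 : 0 <= \sum_(i < n.*2) (tnth x (widen_ord (leqnSn n.*2) i) : R) ^+ 2.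
    by apply: sumr_ge0 => j _; exact: sqr_ge0.
  have Se : \sum_(i < n.*2) (tnth x (widen_ord (leqnSn n.*2) i) : R) ^+ 2 <= e.
    apply: (@le_trans _ _ (\sum_(i < n.*2) e ^+ 2)).
      by apply: ler_sum => i _; apply: sqA; exact: xA.
    rewrite sumr_const card_ord -mulr_natl expr2 mulrA.
    by rewrite ler_piMl// ltW.
  have Te := sqA _ (xA ord_max).
  have e2 : (1 : R) `^ (4%:R^-1) = 1 by rewrite powR1.
  rewrite /hnorm -[ltRHS]e2 gt0_ltr_powR ?invr_gt0// ?nnegrE ?addr_ge0 ?sqr_ge0//.
  by nra.
have mA i : measurable (A i) by exact: measurable_itv.
have mB := measurable_tuple_box mA.
apply: (@lt_le_trans _ _ (haar R n [set x : H | forall i, A i (tnth x i)])); last first.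
  by apply: le_measure => //; rewrite inE//; exact: measurable_hball.
rewrite /haar tuple_measure_box//.
elim/big_ind : _ => // [x y|i _]; first exact: mule_gt0.
rewrite [ltRHS](lebesgue_measure_itv `[- e, e]%R)/= lte_fin gtrN//.
by rewrite -EFinB lte_fin; lra.
Qed.
End heisenberg_balls.

(** * Integrals of powers of the norm over balls *)

Section radial_integral.
Context {R : realType} {n : nat}.
Local Notation H := (heisenberg R n).
Local Notation Q := (homdim R n).
Local Notation haar := (haar R n).
Local Notation Omega := (Omega_Q R n).
Local Notation w := (Q * fine Omega).

Lemma Omega_Q_fin : (fine Omega)%:E = Omega.
Proof. by rewrite fineK// ge0_fin_numE ?Omega_Q_lty// ltW// Omega_Q_gt0. Qed.

Lemma fine_Omega_Q_gt0 : 0 < fine Omega.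
Proof. by rewrite -lte_fin Omega_Q_fin Omega_Q_gt0. Qed.

Lemma omega_QE : omega_Q R n = w%:E.
Proof. by rewrite /omega_Q -Omega_Q_fin EFinM. Qed.

Lemma fine_omega_Q_gt0 : 0 < w.
Proof. by rewrite mulr_gt0 ?homdim_gt0// fine_Omega_Q_gt0. Qed.

Lemma measurable_hnorm_powR (s : R) : measurable_fun [set: H] (fun x : H => hnorm x `^ s).
Proof. by apply: (measurableT_comp (measurable_powR s)); exact: measurable_hnorm. Qed.

Lemma measurable_hnorm_eq0 : measurable [set x : H | hnorm x = 0].
Proof.
rewrite -[X in measurable X]setTI.
exact: (@measurable_hnorm R n measurableT [set (0 : R)] (measurable_set1 _)).
Qed.

(** This set lies in every ball of positive radius, and the radius [(e / Omega)^(1/Q)] gives a ball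
    of measure exactly [e]. *)
Lemma haar_hnorm_eq0 : haar [set x | hnorm x = 0] = 0%E.
Proof.
apply/eqP; rewrite eq_le measure_ge0 andbT.
apply/lee_addgt0Pr => e e0; rewrite add0e.
have O0 := fine_Omega_Q_gt0.
have eO : 0 < e / fine Omega by rewrite divr_gt0.
have r0 : 0 < (e / fine Omega) `^ Q^-1 by rewrite powR_gt0.
apply: (@le_trans _ _ (haar (@hball R n ((e / fine Omega) `^ Q^-1)))).
  apply: le_measure; rewrite ?inE.
  - exact: measurable_hnorm_eq0.
  - exact: measurable_hball.
  - by move=> x /= x0; rewrite /hball/= x0.
rewrite haar_hball// -powRrM mulVf ?gt_eqF ?homdim_gt0//.
rewrite powRr1; last exact: ltW.
by rewrite -Omega_Q_fin -EFinM divfK ?gt_eqF.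
Qed.

(** Where the norm vanishes, [ln] and [powR] take default values that break the laws of exponents;
    computations are done off this null set. *)
Definition punctured_hball (r : R) : set H := @hball R n r `\` [set x | hnorm x = 0].

Lemma punctured_hballE r x : punctured_hball r x <-> 0 < hnorm x < r.
Proof.
rewrite /punctured_hball/hball/= lt0r hnorm_ge0 andbT; split.
  by move=> [-> /eqP ->].
by move=> /andP[/eqP].
Qed.

Lemma measurable_punctured_hball r : measurable (punctured_hball r).
Proof. by apply: measurableD; [exact: measurable_hball|exact: measurable_hnorm_eq0]. Qed.

Lemma haar_punctured_hball r : 0 < r ->
  haar (punctured_hball r) = ((r `^ Q)%:E * Omega)%E.
Proof.
move=> r0; rewrite -haar_hball// measureD.
- rewrite [X in (_ - X)%E](_ : _ = 0%E) ?sube0//.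
  apply/eqP; rewrite eq_le measure_ge0 andbT -haar_hnorm_eq0.
  apply: le_measure; rewrite ?inE; last exact: subIsetr.
    by apply: measurableI; [exact: measurable_hball|exact: measurable_hnorm_eq0].
  exact: measurable_hnorm_eq0.
- exact: measurable_hball.
- exact: measurable_hnorm_eq0.
- by rewrite [ltLHS]haar_hball// -Omega_Q_fin -EFinM ltry.
Qed.

Lemma integral_hball_punctured r (f : H -> \bar R) :
  measurable_fun [set: H] f -> (forall x, 0 <= f x)%E ->
  (\int[haar]_(x in @hball R n r) f x = \int[haar]_(x in punctured_hball r) f x)%E.
Proof.
move=> mf f0; apply: ge0_negligible_integral => //.
- exact: measurable_hnorm_eq0.
- exact: measurable_hball.
- exact: measurable_funTS.
- exact: haar_hnorm_eq0.
Qed.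

(* The coordinate [X = Q (ln r - ln |x|)] of a uniform point of the ball of
   radius [r] is exponentially distributed, as [haar {X > t}] is proportional
   to [exp (- t)]. *)
Lemma haar_log_distribution (r : R) (A : set (measurableTypeR R)) :
  0 < r -> measurable A ->
  haar (punctured_hball r `&` (fun x => Q * (ln r - ln (hnorm x))) @^-1` A)
  = ((r `^ Q)%:E * Omega * std_exponential A)%E.
Proof.
move=> r0 mA; set X := fun x : H => _.
have mX : measurable_fun [set: H] (X : H -> measurableTypeR R).
  apply: measurable_funM => //; apply: measurable_funB => //.
  by apply: measurableT_comp; [exact: measurable_ln|exact: measurable_hnorm].
have Q0 : 0 < Q := homdim_gt0.
have c0 : 0 <= r `^ Q * fine Omega.
  by rewrite mulr_ge0 ?powR_ge0// ltW// fine_Omega_Q_gt0.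
pose m1 : {measure set (measurableTypeR R) -> \bar R} :=
  pushforward (mrestr haar (measurable_punctured_hball r)) (X : H -> measurableTypeR R).
pose m2 : {measure set (measurableTypeR R) -> \bar R} := mscale (NngNum c0) std_exponential.
suff : m1 mX A = m2 A.
  rewrite /m2/= /mscale/= EFinM Omega_Q_fin => <-.
  by rewrite /m1/= /pushforward/mrestr setIC.
have m1E t : m1 mX `]t, +oo[ = m2 `]t, +oo[.
  rewrite /m2/= /mscale/= std_exponential_itvoy.
  (* The condition [X > t] reads [|x| < r exp (- t / Q)], while [X > 0] on the whole punctured ball;
     hence the maximum with [0]. *)
  have -> : m1 mX `]t, +oo[ = haar (punctured_hball (r * expR (- (Num.max 0 t / Q)))).
    rewrite /m1/= /pushforward/mrestr; congr (haar _).
    apply/seteqP; split => x /=.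
      rewrite in_itv/= andbT /X => -[tx /punctured_hballE/andP[x0 xr]].
      apply/punctured_hballE; rewrite x0/=.
      rewrite -ltr_ln ?posrE ?mulr_gt0 ?expR_gt0// lnM ?posrE ?expR_gt0// expRK.
      have : Num.max 0 t < Q * (ln r - ln (hnorm x)).
        rewrite gt_max tx andbT mulr_gt0// subr_gt0 ltr_ln//.
      by rewrite mulrC -ltr_pdivrMr//; lra.
    move=> /punctured_hballE/andP[x0].
    rewrite -ltr_ln ?posrE ?mulr_gt0 ?expR_gt0// lnM ?posrE ?expR_gt0// expRK => h.
    have : Num.max 0 t < Q * (ln r - ln (hnorm x)).
      by rewrite mulrC -ltr_pdivrMr//; lra.
    rewrite gt_max in_itv/= andbT => /andP[h0 ht]; split => //.
    apply/punctured_hballE; rewrite x0/=.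
    by rewrite -ltr_ln// -subr_gt0 -(pmulr_rgt0 _ Q0).
  rewrite haar_punctured_hball ?mulr_gt0 ?expR_gt0//.
  rewrite powRM ?ltW// ?expR_gt0// -expRM mulNr divfK ?gt_eqF//.
  by rewrite -Omega_Q_fin -!EFinM; congr EFin; ring.
(* The open rays are stable under intersection and generate the Borel sets; the rays []-k, +oo[]
   exhaust the line and have finite mass. *)
apply: (@measure_unique _ R (measurableTypeR R) (@RGenOInfty.G R)
  (fun k : nat => `](- k%:R : R), +oo[%classic) _ _ _ _ (m1 mX) m2) => //.
- exact: RGenOInfty.measurableE.
- move=> _ _ [x ->] [y ->]; exists (Num.max x y).
  by apply/seteqP; split => z /=; rewrite !in_itv/= !andbT gt_max => /andP.
- by move=> i; exists (- i%:R).
- apply/seteqP; split => // x _.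
  exists (Num.truncn `|x|).+1 => //=; rewrite in_itv/= andbT ltrNl.
  by rewrite (le_lt_trans _ (truncnS_gt _))// -normrN ler_norm.
- by move=> _ [x ->].
- by move=> k; rewrite m1E /m2/= /mscale/= std_exponential_itvoy -EFinM ltry.
Qed.

(** On the punctured ball [|x|^s = r^s exp (- (s / Q) X)] with [X] exponentially distributed up to
    the mass [r^Q Omega]. The integral is therefore [r^(Q+s) Omega / (1 + s / Q)], and [Q + s > 0]
    is the convergence condition [s / Q > -1]. *)
Lemma integral_hnorm_powR {s r : R} : 0 < r -> 0 < Q + s ->
  (\int[haar]_(x in @hball R n r) (hnorm x `^ s)%:E
   = (r `^ (Q + s) * (w / (Q + s)))%:E)%E.
Proof.
move=> r0 Qs0.
have Q0 : 0 < Q := homdim_gt0.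
rewrite integral_hball_punctured; last 2 first.
- by apply/measurable_EFinP; exact: measurable_hnorm_powR.
- by move=> x; rewrite lee_fin powR_ge0.
pose X := fun x : H => Q * (ln r - ln (hnorm x)) : measurableTypeR R.
pose f := fun t : measurableTypeR R => (r `^ s * expR (- (s / Q * t)))%:E.
have mX : measurable_fun [set: H] X.
  apply: measurable_funM => //; apply: measurable_funB => //.
  by apply: measurableT_comp; [exact: measurable_ln|exact: measurable_hnorm].
have mf : measurable_fun [set: measurableTypeR R] f.
  apply/measurable_EFinP; apply: measurable_funM => //.
  apply: measurableT_comp => //.
  by apply: measurableT_comp => //; exact: mulrl_measurable.
have f0 t : (0 <= f t)%E by rewrite lee_fin mulr_ge0 ?powR_ge0 ?expR_ge0.
have mD := measurable_punctured_hball r.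
have c0 : 0 <= r `^ Q * fine Omega.
  by rewrite mulr_ge0 ?powR_ge0// ltW// fine_Omega_Q_gt0.
(* Passing to the restricted measure turns this into an integral over the whole space, which can be
   pushed forward by [X]. *)
transitivity (\int[mrestr haar mD]_x (f \o X) x)%E.
  have mfX : measurable_fun [set: H] (f \o X) by exact: measurableT_comp.
  have nullC : mrestr haar mD (~` punctured_hball r) = 0%E.
    by rewrite /mrestr setICl measure0.
  rewrite [RHS](ge0_negligible_integral (measurableC mD) measurableT mfX
    (fun x _ => f0 (X x)) nullC) setTD setCK.
  rewrite [RHS](@eq_measure_integral _ _ _ _ haar); last first.
    by move=> A mA AD; rewrite /= /mrestr setIidl.
  apply: eq_integral => x /[!inE] /punctured_hballE /andP[x0 _].
  rewrite /f/X/=; congr EFin.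
  rewrite /powR !gt_eqF// -expRD; congr expR; field.
  by rewrite gt_eqF.
rewrite -(preimage_setT X) -ge0_integral_pushforward//.
rewrite (@eq_measure_integral _ _ _ _ (mscale (NngNum c0) std_exponential)); last first.
  move=> A mA _; rewrite [LHS](_ : _ = haar (punctured_hball r `&` X @^-1` A)).
    by rewrite haar_log_distribution// -[in LHS]Omega_Q_fin -EFinM.
  by rewrite /pushforward/= /mrestr setIC.
rewrite ge0_integral_mscale//=.
rewrite (eq_integral (fun t : measurableTypeR R =>
  ((r `^ s)%:E * (expR (- (s / Q * t)))%:E)%E))//.
rewrite ge0_integralZl_EFin ?powR_ge0//; last first.
  apply/measurable_EFinP; apply: measurableT_comp => //.
  by apply: measurableT_comp => //; exact: mulrl_measurable.
rewrite integral_std_exponential_expR; last first.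
  by rewrite ltr_pdivlMr// mulN1r -subr_gt0 opprK addrC.
rewrite -!EFinM; congr EFin.
rewrite powRD; last by rewrite gt_eqF// implybT.
clear -Q0 Qs0; move: (homdim R n) Q0 Qs0 => q q0 qs0.
by field; rewrite !gt_eqF.
Qed.

End radial_integral.

(* Unlike [ge0_subset_integral], this does not ask for measurable sets: the
   level sets of [hardy alpha f] are only known to lie in a ball. *)
Lemma ge0_integral_subset {d} {T : measurableType d} {R : realType}
    {mu : {measure set T -> \bar R}} {A B : set T} {f : T -> \bar R} :
  A `<=` B -> (forall x, 0 <= f x)%E ->
  (\int[mu]_(x in A) f x <= \int[mu]_(x in B) f x)%E.
Proof.
(* Each integral is a supremum over simple functions below [f] extended by [0] off the set; those
   admissible for [A] are admissible for [B]. *)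
move=> AB f0; rewrite !ge0_integralE//.
apply: ereal_sup_le => _ [h /= hA <-]; exists h => //= x.
apply: (le_trans (hA x)); rewrite !patchE.
case: ifPn => [/set_mem/AB/mem_set ->//|_]; by case: ifP.
Qed.

(** * The two bounds for the Hardy operator *)

Section hardy_norm.
Context {R : realType} {n : nat}.
Local Notation H := (heisenberg R n).
Local Notation Q := (homdim R n).
Local Notation haar := (haar R n).
Local Notation w := (Q * fine (Omega_Q R n)).

(* [a] stands for [beta / (p - 1)]. *)
Lemma integral_hball_le_weighted_Lnorm {p a : R} {f : H -> R} {r : R} :
  1 < p -> a < Q -> measurable_fun [set: H] f -> 0 < r ->
  (`|\int[haar]_(y in @hball R n r) (f y)%:E| <=
   weighted_Lnorm haar (fun x => hnorm x `^ (a * (p - 1)))%R p (EFin \o f)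
   * ((r `^ (Q - a) * (w / (Q - a))) `^ (1 - p^-1))%:E)%E.
Proof.
move=> p1 aQ mf r0.
have p0 : 0 < p by exact: lt_trans p1.
have q0 : 0 < p / (p - 1) by rewrite divr_gt0// subr_gt0.
have pn0 : p != 0 by rewrite gt_eqF.
have pm0 : p - 1 != 0 by rewrite gt_eqF// subr_gt0.
(* This is [beta / p]: then [|F|^p] carries the weight [|y|^(a (p - 1))], and the conjugate power of
   [G] is [|y|^(-a)] on the ball, as [b p / (p - 1) = a]. *)
pose b := a * (p - 1) / p.
pose D := @punctured_hball R n r.
have mD : measurable D by exact: measurable_punctured_hball.
pose F := fun x : H => f x * hnorm x `^ b.
pose G := fun x : H => hnorm x `^ (- b) * \1_D x.
have mF : measurable_fun [set: H] F.
  by apply: measurable_funM => //; exact: measurable_hnorm_powR.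
have mG : measurable_fun [set: H] G.
  by apply: measurable_funM; [exact: measurable_hnorm_powR|exact: measurable_indic].
apply: le_trans.
  apply: le_abse_integral; first exact: measurable_hball.
  exact/measurable_EFinP/measurable_funTS.
rewrite integral_hball_punctured; last 2 first.
- by apply/measurable_EFinP; exact: measurableT_comp.
- by move=> x; exact: abse_ge0.
have pq : p^-1 + (p / (p - 1))^-1 = 1 by field; apply/andP.
have := hoelder haar mF mG p0 q0 pq.
rewrite Lnorm1; set lhs := (X in (X <= _)%E); move=> hol.
rewrite (_ : (\int[haar]_(x in D) `|(f x)%:E| = lhs)%E); last first.
  rewrite [LHS]integral_mkcond; apply: eq_integral => x _.
  rewrite patchE /= /F/G indicE; case: ifPn => xD; last by rewrite !mulr0 normr0.
  move/set_mem/punctured_hballE : xD => /andP[x0 _].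
  by rewrite mulr1 powRN mulfK// gt_eqF// powR_gt0.
apply: (le_trans hol); rewrite unlock.
rewrite (_ : (\int[haar]_x `|(EFin \o F) x| `^ p = \int[haar]_x
    (`|(EFin \o f) x| `^ p * (hnorm x `^ (a * (p - 1)))%:E))%E); last first.
  apply: eq_integral => x _ /=.
  rewrite -EFinM /F normrM (ger0_norm (powR_ge0 _ _)).
  by rewrite (powRM _ (normr_ge0 _) (powR_ge0 _ _)) -powRrM (divfK pn0).
apply: lee_wpmul2l; first exact: poweR_ge0.
rewrite (_ : (\int[haar]_x `|(EFin \o G) x| `^ (p / (p - 1)) =
    \int[haar]_(x in D) (hnorm x `^ (- a))%:E)%E); last first.
  rewrite [RHS]integral_mkcond; apply: eq_integral => x _.
  rewrite patchE /= /G indicE; case: ifPn => xD; last first.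
    by rewrite mulr0 normr0 powR0// gt_eqF.
  have e : - b * (p / (p - 1)) = - a by rewrite /b; field; apply/andP.
  by rewrite mulr1 (ger0_norm (powR_ge0 _ _)) -powRrM e.
rewrite -integral_hball_punctured; last 2 first.
- by apply/measurable_EFinP; exact: measurable_hnorm_powR.
- by move=> x; rewrite lee_fin powR_ge0.
rewrite integral_hnorm_powR// ?subr_gt0// poweR_EFin lee_fin.
by rewrite (_ : (p / (p - 1))^-1 = 1 - p^-1)//; field; apply/andP.
Qed.

Lemma weighted_weak_Lnorm_le (q gamma M : R) (g : H -> \bar R) :
  0 < q -> 0 < Q + gamma -> 0 < M ->
  (forall x, 0 < hnorm x ->
    (`|g x| <= (M * hnorm x `^ (- ((Q + gamma) / q)))%:E)%E) ->
  (weighted_weak_Lnorm haar (fun x => hnorm x `^ gamma)%R q g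
    <= (M * (w / (Q + gamma)) `^ q^-1)%:E)%E.
Proof.
move=> q0 Qg0 M0 gM; apply: ge_ereal_sup => _ [l /= l0 <-].
have w0 := @fine_omega_Q_gt0 R n.
have e0 : 0 < (Q + gamma) / q by rewrite divr_gt0.
(* The radius at which the bound [M rho^(-(Q+gamma)/q)] equals the level [l]. *)
pose rho := (M / l) `^ (q / (Q + gamma)).
have rho0 : 0 < rho by apply: powR_gt0; exact: divr_gt0.
have sub : [set x | (l%:E < `|g x|)%E] `<=` @hball R n rho.
  move=> x /= lg; rewrite /hball/=.
  (* A point of norm [0] escapes the hypothesis on [g], but lies in the ball because [rho > 0]. *)
  have := hnorm_ge0 x; rewrite le_eqVlt => /predU1P[<- //|x0].
  have := lt_le_trans lg (gM x x0); rewrite lte_fin powRN.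
  rewrite ltr_pdivlMr; last exact: (powR_gt0 _ x0).
  rewrite mulrC -ltr_pdivlMr// => h.
  rewrite -[ltLHS](powRr1 (ltW x0)).
  rewrite (_ : 1 = (Q + gamma) / q * (q / (Q + gamma))); last first.
    by rewrite mulrA divfK ?gt_eqF// divff ?gt_eqF.
  rewrite powRrM; apply: gt0_ltr_powR => //; first exact: divr_gt0.
    by rewrite nnegrE powR_ge0.
  by rewrite nnegrE divr_ge0// ltW.
have int_le := ge0_integral_subset (mu := haar) sub
  (fun x => powR_ge0 (hnorm x) gamma : (0 <= (hnorm x `^ gamma)%:E)%E).
rewrite integral_hnorm_powR// in int_le.
have h : ((\int[haar]_(x in [set x | (l%:E < `|g x|)%E]) (hnorm x `^ gamma)%:E) `^ q^-1
    <= ((rho `^ (Q + gamma) * (w / (Q + gamma))) `^ q^-1)%:E)%E.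
  rewrite -poweR_EFin; apply: gt0_ler_poweR => //.
  - by rewrite invr_ge0 ltW.
  - by rewrite in_itv/= leey andbT; apply: integral_ge0 => x _; rewrite lee_fin powR_ge0.
  - by rewrite in_itv/= leey andbT lee_fin mulr_ge0 ?powR_ge0// divr_ge0 ?ltW.
apply: le_trans (lee_wpmul2l _ h) _; first by rewrite lee_fin ltW.
rewrite -EFinM lee_fin powRM ?powR_ge0//; last by rewrite divr_ge0 ?ltW.
(* Since [rho^((Q+gamma)/q) = M / l], the level cancels and the bound is uniform in [l]. *)
rewrite /rho -!powRrM (_ : q / (Q + gamma) * _ = 1); last first.
  by rewrite mulrA divfK ?gt_eqF// divff ?gt_eqF.
rewrite powRr1; last by rewrite divr_ge0 ?ltW.
by rewrite mulrA (mulrC l) divfK ?gt_eqF.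
Qed.

(** The single level [l] suffices: its level set contains the punctured unit ball, of weighted
    measure [w / (Q + gamma)]. *)
Lemma weighted_weak_Lnorm_ge (q gamma l : R) (g : H -> \bar R) :
  0 < q -> 0 < Q + gamma -> 0 < l ->
  (forall x, 0 < hnorm x < 1 -> (l%:E < `|g x|)%E) ->
  ((l * (w / (Q + gamma)) `^ q^-1)%:E <=
    weighted_weak_Lnorm haar (fun x => hnorm x `^ gamma)%R q g)%E.
Proof.
move=> q0 Qg0 l0 lg.
have w0 := @fine_omega_Q_gt0 R n.
apply: le_trans; last by apply: ereal_sup_ubound; exists l.
rewrite EFinM; apply: lee_wpmul2l; first by rewrite lee_fin ltW.
have sub : @punctured_hball R n 1 `<=` [set x | (l%:E < `|g x|)%E].
  by move=> x /punctured_hballE; exact: lg.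
have := ge0_integral_subset (mu := haar) sub
  (fun x => powR_ge0 (hnorm x) gamma : (0 <= (hnorm x `^ gamma)%:E)%E).
rewrite -integral_hball_punctured; last 2 first.
- by apply/measurable_EFinP; exact: measurable_hnorm_powR.
- by move=> x; rewrite lee_fin powR_ge0.
rewrite integral_hnorm_powR// powR1 mul1r => h.
rewrite -poweR_EFin; apply: gt0_ler_poweR => //.
- by rewrite invr_ge0 ltW.
- by rewrite in_itv/= leey andbT lee_fin divr_ge0 ?ltW.
- by rewrite in_itv/= leey andbT; apply: integral_ge0 => x _; rewrite lee_fin powR_ge0.
Qed.

Lemma hardy_upper_bound {p q alpha a gamma : R} {f : H -> R} :
  1 < p -> 0 < q -> a < Q -> 0 < Q + gamma ->
  (Q + gamma) / q + alpha = (a * (p - 1) + Q) / p ->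
  measurable_fun [set: H] f ->
  let N := weighted_Lnorm haar (fun x => hnorm x `^ (a * (p - 1)))%R p (EFin \o f) in
  (0 < N)%E -> (N < +oo)%E ->
  (weighted_weak_Lnorm haar (fun x => hnorm x `^ gamma)%R q (hardy alpha f) / N
    <= ((w / (Q + gamma)) `^ q^-1 * (w / (Q - a)) `^ (1 - p^-1))%:E)%E.
Proof.
move=> p1 q0 aQ Qg0 scal mf N N0 Noo.
have w0 := @fine_omega_Q_gt0 R n.
have p0 : 0 < p by exact: lt_trans p1.
have Qa0 : 0 < Q - a by rewrite subr_gt0.
have [N' N'E] : exists N', N = N'%:E.
  by exists (fine N); rewrite fineK// ge0_fin_numE// ltW.
have N'0 : 0 < N' by rewrite -lte_fin -N'E.
pose A := (w / (Q - a)) `^ (1 - p^-1).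
have A0 : 0 < A by apply: powR_gt0; exact: divr_gt0.
have bound (x : H) : 0 < hnorm x ->
    (`|hardy alpha f x| <= (N' * A * hnorm x `^ (- ((Q + gamma) / q)))%:E)%E.
  move=> x0; rewrite /hardy abseM gee0_abs; last by rewrite lee_fin invr_ge0 powR_ge0.
  have := integral_hball_le_weighted_Lnorm p1 aQ mf x0.
  rewrite -/N N'E -EFinM => h.
  apply: le_trans (lee_wpmul2l _ h) _; first by rewrite lee_fin invr_ge0 powR_ge0.
  rewrite -EFinM lee_fin powRM ?powR_ge0//; last by rewrite divr_ge0 ?ltW.
  rewrite -powRrM -/A -powRN.
  (* The scaling relation enters here: the power [-(Q - alpha)] in the operator and the power of the
     radius from Hoelder add up to the decay required by [weighted_weak_Lnorm_le]. *)
  rewrite (_ : - ((Q + gamma) / q) = - (Q - alpha) + (Q - a) * (1 - p^-1)); last first.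
    have -> : (Q + gamma) / q = (a * (p - 1) + Q) / p - alpha by rewrite -scal addrK.
    clear -p0; move: (homdim R n) => Q'; field; by rewrite gt_eqF.
  rewrite powRD; last by rewrite (gt_eqF x0) implybT.
  by rewrite le_eqVlt; apply/orP; left; apply/eqP; ring.
have := weighted_weak_Lnorm_le _ _ _ _ q0 Qg0 (mulr_gt0 N'0 A0) bound.
set B := (w / (Q + gamma)) `^ q^-1; rewrite N'E => h.
rewrite inver gt_eqF//; apply: le_trans (lee_wpmul2r _ h) _.
  by rewrite lee_fin invr_ge0 ltW.
rewrite -EFinM lee_fin -/A le_eqVlt; apply/orP; left; apply/eqP.
by field; rewrite gt_eqF.
Qed.

(** The witness is the equality case of Hoelder's inequality above: for [f y = |y|^(-a)] on the unit
    ball, [|f|^p |y|^(a (p - 1))] is again [|y|^(-a)], the conjugate power of the other factor.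
    Cutting off at radius [1] keeps the norm finite. *)
Lemma hardy_lower_bound {p q alpha a gamma : R} :
  1 < p -> 0 < q -> alpha < a -> a < Q -> 0 < Q + gamma ->
  exists f : H -> R,
  let N := weighted_Lnorm haar (fun x => hnorm x `^ (a * (p - 1)))%R p (EFin \o f) in
  [/\ measurable_fun [set: H] f, (0 < N)%E, (N < +oo)%E &
  (((w / (Q + gamma)) `^ q^-1 * (w / (Q - a)) `^ (1 - p^-1))%:E
   <= weighted_weak_Lnorm haar (fun x => hnorm x `^ gamma)%R q (hardy alpha f) / N)%E].
Proof.
move=> p1 q0 alphaa aQ Qg0.
have w0 := @fine_omega_Q_gt0 R n.
have p0 : 0 < p by exact: lt_trans p1.
have Qa0 : 0 < Q - a by rewrite subr_gt0.
pose C := w / (Q - a).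
have C0 : 0 < C by exact: divr_gt0.
pose D := @punctured_hball R n 1.
have mD : measurable D by exact: measurable_punctured_hball.
pose f := fun x : H => hnorm x `^ (- a) * \1_D x.
have mf : measurable_fun [set: H] f.
  by apply: measurable_funM; [exact: measurable_hnorm_powR|exact: measurable_indic].
have mh : measurable_fun [set: H] (fun x : H => (hnorm x `^ (- a))%:E).
  by apply/measurable_EFinP; exact: measurable_hnorm_powR.
have h0 (x : H) : (0 <= (hnorm x `^ (- a))%:E)%E by rewrite lee_fin powR_ge0.
exists f => N.
have NE : N = (C `^ p^-1)%:E.
  rewrite /N /weighted_Lnorm -poweR_EFin; congr (_ `^ _)%E.
  transitivity (\int[haar]_(x in D) (hnorm x `^ (- a))%:E)%E.
    rewrite [RHS]integral_mkcond; apply: eq_integral => x _.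
    rewrite patchE /= /f indicE; case: ifPn => xD; last first.
      by rewrite mulr0 normr0 powR0 ?gt_eqF// mul0e.
    move/set_mem/punctured_hballE : xD => /andP[x0 _].
    rewrite mulr1 (ger0_norm (powR_ge0 _ _)) -EFinM -powRrM -powRD; last first.
      by rewrite (gt_eqF x0) implybT.
    by rewrite (_ : - a * p + a * (p - 1) = - a)//; ring.
  by rewrite -integral_hball_punctured// integral_hnorm_powR// powR1 mul1r.
have Cp0 : 0 < C `^ p^-1 by exact: powR_gt0.
split; [exact: mf|by rewrite NE lte_fin|by rewrite NE ltry|].
have hf (x : H) : 0 < hnorm x < 1 -> (C%:E < `|hardy alpha f x|)%E.
  move=> /andP[x0 x1].
  (* As [|x| < 1], the ball of integration lies inside the unit ball and the cut-off of [f] is not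
     seen. *)
  have -> : hardy alpha f x = (C * hnorm x `^ (alpha - a))%:E.
    rewrite /hardy (_ : (\int[haar]_(y in @hball R n (hnorm x)) (f y)%:E
      = \int[haar]_(y in @hball R n (hnorm x)) (hnorm y `^ (- a))%:E)%E); last first.
      rewrite !integral_hball_punctured//; last 2 first.
      - by apply/measurable_EFinP.
      - by move=> y; rewrite lee_fin mulr_ge0 ?powR_ge0.
      apply: eq_integral => y /set_mem/punctured_hballE/andP[y0 yx].
      rewrite /f indicE mem_set ?mulr1//.
      by apply/punctured_hballE; rewrite y0 (lt_trans yx).
    rewrite integral_hnorm_powR// -EFinM -powRN; congr EFin.
    rewrite [LHS]mulrA -powRD; last by rewrite (gt_eqF x0) implybT.
    by rewrite (_ : - (Q - alpha) + (Q - a) = alpha - a) 1?mulrC//; ring.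
  rewrite gee0_abs; last by rewrite lee_fin mulr_ge0 ?powR_ge0 ?(ltW C0).
  rewrite lte_fin ltr_pMr//.
  (* Level sets are given by a strict inequality, so [|x|^(alpha - a) > 1] is needed; it follows
     from [alpha < a] and [|x| < 1]. *)
  rewrite -opprB powRN invf_gt1; last exact: (powR_gt0 _ x0).
  have e : (1 : R) `^ (a - alpha) = 1 by rewrite powR1.
  rewrite -[ltRHS]e; apply: gt0_ltr_powR => //; first by rewrite subr_gt0.
    by rewrite nnegrE hnorm_ge0.
  by rewrite nnegrE.
have := weighted_weak_Lnorm_ge _ _ _ _ q0 Qg0 C0 hf.
set B := (w / (Q + gamma)) `^ q^-1; rewrite NE => h.
rewrite inver gt_eqF//; apply: le_trans (lee_wpmul2r _ h); last first.
  by rewrite lee_fin invr_ge0 ltW.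
(* The level [C] divided by the norm [C^(1/p)] gives the factor [C^(1 - 1/p)]. *)
rewrite -EFinM lee_fin -/C powRB; last by rewrite (gt_eqF C0) implybT.
by rewrite (powRr1 (ltW C0)) mulrCA mulrA.
Qed.

End hardy_norm.

(* The operator norm *)
Local Close Scope classical_set_scope.

Theorem theorem2p1 (R : realType) (n : nat) (p q alpha beta gamma : R)
    (n_ge1 : (1 <= n)%N) (p_gt1 : 1 < p) (q_ge1 : 1 <= q)
    (beta_lt : beta < homdim R n * (p - 1))
    (Qgamma_gt0 : 0 < homdim R n + gamma)
    (alpha_ge0 : 0 <= alpha) (alpha_lt : alpha < beta / (p - 1))
    (scaling : (gamma + homdim R n) / q + alpha = (beta + homdim R n) / p) :
  let Q := homdim R n in
  let p' := p / (p - 1) in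
  operator_norm
    (weighted_Lnorm (haar R n) (fun x => hnorm x `^ beta) p)
    (weighted_weak_Lnorm (haar R n) (fun x => hnorm x `^ gamma) q)
    (hardy alpha)
  = ((omega_Q R n / (Q + gamma)%:E) `^ q^-1
     * (omega_Q R n * (p - 1)%:E / (p * Q - Q - beta)%:E) `^ p'^-1)%E.
Proof.
move=> Q p'.
have p0 : 0 < p by exact: lt_trans p_gt1.
have pm0 : 0 < p - 1 by rewrite subr_gt0.
have q0 : 0 < q by exact: lt_le_trans q_ge1.
pose a := beta / (p - 1).
have betaE : beta = a * (p - 1) by rewrite /a divfK ?gt_eqF.
have aQ : a < Q by rewrite /a ltr_pdivrMr.
have scal : (Q + gamma) / q + alpha = (a * (p - 1) + Q) / p.
  by rewrite -betaE [Q + gamma]addrC.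
have p'E : p'^-1 = 1 - p^-1.
  by rewrite /p'; field; rewrite !gt_eqF.
set w := Q * fine (Omega_Q R n).
have -> : (omega_Q R n / (Q + gamma)%:E = (w / (Q + gamma))%:E)%E.
  by rewrite omega_QE inver gt_eqF.
have -> : (omega_Q R n * (p - 1)%:E / (p * Q - Q - beta)%:E = (w / (Q - a))%:E)%E.
  (* This factorisation cancels the [p - 1] of the numerator and leaves the constant [w / (Q - a)]
     of the two bounds. *)
  have E : p * Q - Q - beta = (p - 1) * (Q - a) by rewrite betaE; ring.
  have E0 : 0 < (p - 1) * (Q - a) by rewrite mulr_gt0 ?subr_gt0.
  rewrite omega_QE E inver gt_eqF// -!EFinM -/w; congr EFin.
  by rewrite invfM mulrA mulfK// gt_eqF.
rewrite !poweR_EFin p'E -EFinM betaE.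
apply/eqP; rewrite eq_le; apply/andP; split.
  apply: ge_ereal_sup => _ [f /= [mf N0 Noo] <-].
  exact: hardy_upper_bound.
have [f [mf N0 Noo h]] := hardy_lower_bound (n := n) p_gt1 q0 alpha_lt aQ Qgamma_gt0.
by apply: (le_trans h); apply: ereal_sup_ubound; exists f.
Qed.
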